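(* Let $n\geq 2$ be a positive integer. Then $$\det(\mathrm{rcir}(\boldsymbol{c}_n(-i)))=\begin{cases}0 & \text{if } n\equiv 0 \pmod 4,\\ (2i)^{\frac{n-1}{2}} & \text{if } n\equiv 1\pmod 4\text{ or } n\equiv 3\pmod 4,\\ 2^{n-1} & \text{if } n\equiv 2\pmod 4.\end{cases}$$
   Context: Here $i$ is the imaginary unit. For $\boldsymbol{a}=(a_0,a_1,\dots,a_{n-1})\in\mathbb{C}^n$, $\mathrm{rcir}(\boldsymbol{a})$ denotes the $n\times n$ complex right circulant matrix with first row $\boldsymbol{a}$, each subsequent row being the preceding row rotated one position to the right; i.e., indexing rows and columns by $0,\dots,n-1$, its $(j,k)$ entry is $a_{(k-j)\bmod n}$. For a nonzero complex number $z$, $\boldsymbol{c}_n(z)=\left(\binom{n-1}{0}z^0,\binom{n-1}{1}z^1,\dots,\binom{n-1}{n-1}z^{n-1}\right)\in\mathbb{C}^n$ is the vector of coefficients of $(x+zy)^{n-1}$. *)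

(* Defs.v *)
From mathcomp Require Import all_boot all_algebra.

Set Implicit Arguments.
Unset Strict Implicit.
Unset Printing Implicit Defensive.

Import GRing.Theory.
Local Open Scope ring_scope.

(* The residue (k - j) mod n; the subtraction n - j does not truncate. *)
Definition ord_diffmod (n : nat) (k j : 'I_n) : 'I_n :=
  Ordinal (ltn_pmod (k + (n - j)) (leq_ltn_trans (leq0n j) (ltn_ord j))).

Definition rcir (T : Type) (n : nat) (a : 'rV[T]_n) : 'M[T]_n :=
  \matrix_(j < n, k < n) a 0 (ord_diffmod k j).

Definition binom_row (C : nzRingType) (n : nat) (z : C) : 'rV[C]_n :=
  \row_(k < n) ('C(n.-1, k)%:R * z ^+ k).

(* Main.v *)
(** If P is the matrix of the cyclic shift, the binomial theorem gives
    rcir (binom_row n z) = (1 + z P)^(n-1), while expansion along the first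
    column gives det (1 + z P) = 1 - (-z)^n.  At z = -i the determinant is
    therefore (1 - i^n)^(n-1), and for odd n one uses (1 -+ i)^2 = -+ 2i. *)

Require Import Defs.
From mathcomp Require Import all_boot all_order all_algebra.
From mathcomp Require Import reals complex.
From mathcomp Require Import zify ring.

Set Implicit Arguments.
Unset Strict Implicit.
Unset Printing Implicit Defensive.

Import GRing.Theory Num.Theory.
Local Open Scope ring_scope.

Lemma det_mxX (A : comNzRingType) (m k : nat) (B : 'M[A]_m.+1) :
  \det (B ^+ k) = \det B ^+ k.
Proof.
elim: k => [|k IHk]; first by rewrite !expr0 det1.
by rewrite !exprS detM IHk.
Qed.

Definition shift_mx (A : nzRingType) (m : nat) : 'M[A]_m.+1 :=
  \matrix_(i, j) (j == i.+1 %% m.+1 :> nat)%N%:R.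

Lemma shift_mxX (A : nzRingType) (m k : nat) :
  shift_mx A m ^+ k = \matrix_(i, j) (j == (i + k) %% m.+1 :> nat)%N%:R.
Proof.
elim: k => [|k IHk].
  apply/matrixP=> i j; rewrite expr0 !mxE addn0 modn_small //.
  by rewrite eq_sym -val_eqE.
apply/matrixP=> i j; rewrite exprSr IHk !mxE.
have lt_ik : ((i + k) %% m.+1 < m.+1)%N by rewrite ltn_mod.
rewrite (bigD1 (Ordinal lt_ik)) //= big1 => [|l].
  by rewrite !mxE eqxx mul1r addr0 /= -(addn1 (_ %% _)) modnDml addn1 addnS.
by rewrite -val_eqE /= !mxE => /negbTE ->; rewrite mul0r.
Qed.

(** Adding [n - i], which does not truncate, to both sides solves the congruence for [k]. This
    matches the position of the ones in the [k]-th shift power with the index used by [rcir]. *)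
Lemma eq_add_mod_diff (n i j k : nat) : (i < n)%N -> (j < n)%N -> (k < n)%N ->
  (j == (i + k) %% n)%N = (k == (j + (n - i)) %% n)%N.
Proof.
move=> lt_in lt_jn lt_kn; rewrite -{1}(modn_small lt_jn) -{2}(modn_small lt_kn).
rewrite -(eqn_modDr (n - i)).
have -> : (i + k + (n - i) = k + n)%N by lia.
by rewrite modnDr eq_sym.
Qed.

Lemma rcir_binom_row (A : comNzRingType) (m : nat) (z : A) :
  rcir (binom_row m.+1 z) = (1 + z *: shift_mx A m) ^+ m.
Proof.
rewrite exprDn_comm; last exact: commr_sym (commr1 _).
apply/matrixP=> i j; rewrite !mxE summxE.
(* In the binomial expansion, only one power of the shift has a nonzero [(i, j)] entry. *)
rewrite (bigD1 (ord_diffmod j i)) //= big1 => [|k].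
  rewrite addr0 expr1n mul1r exprZn shift_mxX mulmxnE !mxE.
  by rewrite eq_add_mod_diff // ?ltn_mod // eqxx mulr1 mulr_natl.
rewrite -val_eqE /= => /negbTE neq_k.
rewrite expr1n mul1r exprZn shift_mxX mulmxnE !mxE.
by rewrite eq_add_mod_diff // neq_k mulr0 mul0rn.
Qed.

Lemma det_one_add_shift (A : comNzRingType) (m : nat) (z : A) :
  \det (1 + z *: shift_mx A m) = 1 - (- z) ^+ m.+1.
Proof.
set M := 1 + _.
(* The one of row [a] sits in column [a + 1], or in column 0 when [a = m], so never in columns 1 to
   [a]. *)
have no_shift a b : (a <= m)%N -> (0 < b <= a)%N ->
    (b == a.+1 %% m.+1)%N = false.
  rewrite leq_eqVlt => /orP[/eqP->|lt_am] b_range.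
    by rewrite modnn; lia.
  by rewrite modn_small //; lia.
(* This minor is upper unitriangular; it is transposed because [det_trig] wants a lower triangular
   matrix. *)
have cof0 : cofactor M ord0 ord0 = 1.
  rewrite /cofactor addn0 expr0 mul1r -det_tr det_trig.
    rewrite big1 // => i _; rewrite !mxE eqxx !lift0.
    have -> : (i.+1 == i.+2 %% m.+1)%N = false 
      by apply: no_shift; [exact: ltn_ord | lia].
    by rewrite mulr0 addr0.
  apply/is_trig_mxP => i j lt_ij; rewrite !mxE -(inj_eq (@ord_inj _)) !lift0.
  have [-> ->] : (j.+1 == i.+1)%N = false /\ (i.+1 == j.+2 %% m.+1)%N = false.
    split; first lia.
    by apply: no_shift; [exact: ltn_ord | lia].
  by rewrite mulr0 addr0.
(* Dropping the last row moves the shift entries [z] onto the diagonal and the ones below it; the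
   cofactor sign turns [z ^+ m] into [(- z) ^+ m]. *)
have cofm : cofactor M ord_max ord0 = (- z) ^+ m.
  rewrite /cofactor addn0 det_trig.
    rewrite [in RHS]exprNn; congr (_ * _).
    rewrite (eq_bigr (fun=> z)) ?prodr_const ?card_ord // => i _.
    rewrite !mxE -(inj_eq (@ord_inj _)) lift0 lift_max modn_small ?ltnS ?ltn_ord //.
    by rewrite eqxx mulr1 ltn_eqF ?add0r.
  apply/is_trig_mxP => i j lt_ij; rewrite !mxE -(inj_eq (@ord_inj _)) lift0 lift_max.
  rewrite modn_small ?ltnS ?ltn_ord //.
  have [-> ->] : (i == j.+1 :> nat)%N = false /\ (j.+1 == i.+1)%N = false by lia.
  by rewrite mulr0 addr0.
rewrite (expand_det_col _ ord0).
(* A sum of two indicators also covers [m = 0], where [ord0] and [ord_max] coincide. *)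
have colM i : M i ord0 = (i == ord0)%:R + z * (i == ord_max)%:R.
  rewrite !mxE; congr (_ + z * _%:R); rewrite -val_eqE /= eq_sym.
  have := ltn_ord i; rewrite ltnS leq_eqVlt => /orP[/eqP->|lt_im].
    by rewrite modnn !eqxx.
  by rewrite modn_small // (ltn_eqF lt_im).
under eq_bigr => i _ do rewrite colM mulrDl.
rewrite big_split /=.
rewrite (bigD1 ord0) //= big1 => [|i /negbTE->]; last by rewrite mul0r.
rewrite (bigD1 ord_max) //= big1 => [|i /negbTE->]; last by rewrite mulr0 mul0r.
by rewrite !eqxx cof0 cofm exprS !addr0 !mul1r mulr1 mulNr opprK.
Qed.

Theorem theorem3p13 (R : realType) (n : nat) (hn : (2 <= n)%N) :
  \det (rcir (binom_row n (- 'i%C : R[i]))) =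
    if (n == 0 %[mod 4])%N then 0
    else if (n == 1 %[mod 4])%N || (n == 3 %[mod 4])%N
    then (2 * 'i%C) ^+ (n.-1)./2
    else 2 ^+ n.-1.
Proof.
case: n hn => // m _; rewrite rcir_binom_row.
rewrite det_mxX det_one_add_shift opprK /=.
set I : R[i] := 'i%C; have I2 : I ^+ 2 = -1 by exact: sqr_i.
have I4 : I ^+ 4 = 1 by rewrite -[4%N]/(2 * 2)%N exprM I2 sqrrN expr1n.
(* Only the residue of [m.+1] modulo 4 now matters for the base of the power. *)
rewrite -(expr_mod _ I4).
have : (m.+1 %% 4 < 4)%N by rewrite ltn_mod.
case r_eq: (m.+1 %% 4)%N => [|[|[|[|r]]]] //= _.
- have /negbTE m_neq0 : m != 0%N by lia.
  by rewrite expr0 subrr expr0n m_neq0.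
(* Here [m./2] is even, which absorbs the sign in [(1 - I) ^+ 2 = - (2 * I)]. *)
- have -> : m./2 = (2 * (m.+1 %/ 4))%N by lia.
  have {1}-> : m = (2 * (2 * (m.+1 %/ 4)))%N by lia.
  rewrite expr1 !exprM.
  have -> : (1 - I) ^+ 2 = - (2 * I) by ring: I2.
  by rewrite sqrrN.
- by rewrite I2 opprK.
(* Here [m./2] is odd, but [I ^+ 3 = - I] makes the base [1 + I], whose square is [2 * I] with no
   sign to absorb. *)
- have -> : m./2 = (m.+1 %/ 4 * 2).+1 by lia.
  have {1}-> : m = (2 * (m.+1 %/ 4 * 2).+1)%N by lia.
  rewrite exprM; congr (_ ^+ _).
  by ring: I2.
Qed.
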